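(* Let $q$ be a prime power, $m,t$ positive integers and $k\ge2$. Let $\mathcal{U}=(\mathcal{U}_1,\dots,\mathcal{U}_t)$ be a cutting system in $\mathbb{F}_{q^m}^k$. Then $\mathcal{U}$, regarded as a tuple of $\mathbb{F}_q$-subspaces of $\mathbb{F}_{q^{m(k-1)}}^k$ via the inclusion $\mathbb{F}_{q^m}\subseteq\mathbb{F}_{q^{m(k-1)}}$, is a sum-rank $(k-1)$-saturating system in $\mathbb{F}_{q^{m(k-1)}}^k$.
   Context: A system in $\mathbb{F}_{q^m}^k$ is a tuple $(\mathcal{U}_1,\dots,\mathcal{U}_t)$ of $\mathbb{F}_q$-subspaces of $\mathbb{F}_{q^m}^k$ whose union spans $\mathbb{F}_{q^m}^k$ over $\mathbb{F}_{q^m}$. For a field extension $\mathbb{F}_{Q}\supseteq\mathbb{F}_q$ and an $\mathbb{F}_q$-subspace $W\le\mathbb{F}_Q^k$, $L_W=\{\langle u\rangle_{\mathbb{F}_Q}:u\in W\setminus\{0\}\}\subseteq\mathrm{PG}(k-1,Q)$. The system is cutting if $L_{\mathcal{U}_1}\cup\cdots\cup L_{\mathcal{U}_t}$ is a strong blocking set of $\mathrm{PG}(k-1,q^m)$, i.e. for every hyperplane $\mathcal{H}$ of $\mathrm{PG}(k-1,q^m)$, the $\mathbb{F}_{q^m}$-span of $(L_{\mathcal{U}_1}\cup\cdots\cup L_{\mathcal{U}_t})\cap\mathcal{H}$ equals $\mathcal{H}$. A point set $\mathcal{S}$ of $\mathrm{PG}(k-1,Q)$ is $s$-saturating if every point lies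 in the $\mathbb{F}_Q$-span of some $s+1$ points of $\mathcal{S}$ and $s$ is minimal with this property; a system in $\mathbb{F}_Q^k$ is sum-rank $\rho$-saturating if the union of the linear sets (over $\mathbb{F}_Q$) of its components is $(\rho-1)$-saturating in $\mathrm{PG}(k-1,Q)$. *)

(* Defs.v *)
From HB Require Import structures.
From mathcomp Require Import all_boot all_order all_algebra all_fingroup all_solvable all_field.

Set Implicit Arguments.
Unset Strict Implicit.
Unset Printing Implicit Defensive.

Import GRing.Theory.
Local Open Scope ring_scope.

(* F_q-subspaces of Q^k, where F_q is viewed inside Q through iota. *)
Definition is_subspace (F Q : finFieldType) (iota : {rmorphism F -> Q})
    (k : nat) (W : {set 'rV[Q]_k}) : Prop :=
  [/\ 0 \in W,
      {in W &, forall u v, u + v \in W}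
    & forall a : F, {in W, forall u, iota a *: u \in W}].

Definition is_system (F Q : finFieldType) (iota : {rmorphism F -> Q})
    (k t : nat) (U : 'I_t -> {set 'rV[Q]_k}) : Prop :=
  (forall i, is_subspace iota (U i))
  /\ <<enum (\bigcup_i U i)>>%VS = fullv.

(* Projective subspaces of PG(k-1, Q) are vector subspaces of Q^k; points have
   vector dimension 1, hyperplanes k - 1. *)
Definition point_set (Q : finFieldType) (k : nat) := pred {vspace 'rV[Q]_k}.

Definition is_point (Q : finFieldType) (k : nat) (P : {vspace 'rV[Q]_k}) : bool :=
  \dim P == 1%N.

Definition is_hyperplane (Q : finFieldType) (k : nat) (H : {vspace 'rV[Q]_k}) : bool :=
  \dim H == (k - 1)%N.

Definition linear_set (Q : finFieldType) (k : nat) (W : {set 'rV[Q]_k}) :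
    point_set Q k :=
  fun P => [exists u in W, (u != 0) && (P == <[u]>%VS)].

Definition linear_sets_union (Q : finFieldType) (k t : nat)
    (U : 'I_t -> {set 'rV[Q]_k}) : point_set Q k :=
  fun P => [exists i, linear_set (U i) P].

(* The points of S are enumerated through their nonzero representatives. *)
Definition span_points (Q : finFieldType) (k : nat) (S : point_set Q k) :
    {vspace 'rV[Q]_k} :=
  (\sum_(u : 'rV[Q]_k | (u != 0%R) && S <[u]>%VS) <[u]>)%VS.

Definition strong_blocking (Q : finFieldType) (k : nat) (S : point_set Q k) : Prop :=
  forall H : {vspace 'rV[Q]_k}, is_hyperplane H ->
    span_points (fun P => S P && (P <= H)%VS) = H.

Definition cutting_system (F Q : finFieldType) (iota : {rmorphism F -> Q})
    (k t : nat) (U : 'I_t -> {set 'rV[Q]_k}) : Prop :=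
  is_system iota U /\ strong_blocking (linear_sets_union U).

Definition saturates (Q : finFieldType) (k : nat) (S : point_set Q k) (s : nat) : Prop :=
  forall P : {vspace 'rV[Q]_k}, is_point P ->
    exists T : s.+1.-tuple {vspace 'rV[Q]_k},
      [/\ uniq T, all S T & (P <= \sum_(X <- T) X)%VS].

Definition saturating (Q : finFieldType) (k : nat) (S : point_set Q k) (s : nat) : Prop :=
  saturates S s /\ forall s' : nat, (s' < s)%N -> ~ saturates S s'.

(* The guard on rho makes rho - 1 a genuine subtraction. *)
Definition sum_rank_saturating_system (F Q : finFieldType)
    (iota : {rmorphism F -> Q}) (k t : nat) (U : 'I_t -> {set 'rV[Q]_k})
    (rho : nat) : Prop :=
  [/\ is_system iota U,
      (0 < rho)%N
    & saturating (linear_sets_union U) (rho - 1)%N].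

Definition extend_system (K Q : finFieldType) (jota : {rmorphism K -> Q})
    (k t : nat) (U : 'I_t -> {set 'rV[K]_k}) : 'I_t -> {set 'rV[Q]_k} :=
  fun i => [set map_mx jota u | u in U i].

(* Main.v *)
Require Import Defs.
From HB Require Import structures.
From mathcomp Require Import all_boot all_order all_algebra all_fingroup all_solvable all_field.

Set Implicit Arguments.
Unset Strict Implicit.
Unset Printing Implicit Defensive.

Import GRing.Theory.
Local Open Scope ring_scope.

(** Put [K = F_{q^m}], [Q = F_{q^{m(k-1)}}] and let [b] be a [K]-basis of [Q]
    with [k-1] elements.  Every [v] in [Q^k] is [sum_i b_i a_i] with [k-1]
    vectors [a_i] of [K^k], which lie in a common hyperplane [H] of [K^k].  As
    the system is cutting, [H] has a basis consisting of representatives of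
    points of the system, and [v] is in the [Q]-span of these [k-1] points.
    Conversely, if the [a_i] are linearly independent and [v] is in the
    [Q]-span of vectors of [K^k], then every [K]-linear form vanishing on the
    latter vanishes on all [a_i], so at least [k-1] vectors are needed. *)

Section Vspace.

Variables (K : fieldType) (vT : vectType K).

(** Adjoining an outside vector raises the dimension by exactly one. This supplies the hyperplane
    through the [a_i], which may themselves be dependent. *)
Lemma exists_supspace_dim (V : {vspace vT}) (d : nat) :
  (\dim V <= d <= \dim {:vT})%N -> exists2 W : {vspace vT}, (V <= W)%VS & \dim W = d.
Proof.
elim: d => [|d IHd] /andP[leVd led].
  by exists V => //; apply/eqP; rewrite -leqn0.
move: leVd; rewrite leq_eqVlt => /orP[/eqP dV|leVd]; first by exists V.
have [|W sVW dW] := IHd; first by rewrite -ltnS leVd ltnW.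
have /subvPn[w _ wNW] : ~~ ({:vT} <= W)%VS.
  by apply/negP => /dimvS; rewrite dW leqNgt led.
exists (W + <[w]>)%VS; first exact: subv_trans (addvSl _ _).
have w0 : w != 0 by apply: contraNneq wNW => ->; exact: mem0v.
rewrite dimv_disjoint_sum ?dim_vline ?w0 ?dW ?addn1 //.
apply/eqP; rewrite -subv0; apply/subvP => x; rewrite memv_cap memv0.
case/andP => xW /vlineP[c xE]; move: xW; rewrite {}xE => xW.
have [->|c0] := eqVneq c 0; first by rewrite scale0r.
by case/negP: wNW; rewrite -[w](scalerK c0) memvZ.
Qed.

(** Each vector already in the span of those after it is dropped. Applied to representatives of the
    points in [H], this yields a basis of [H] made of such representatives. *)
Lemma free_subset_span (X : seq vT) :
  exists Y, [/\ free Y, {subset Y <= X} & <<Y>>%VS = <<X>>%VS].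
Proof.
elim: X => [|x X [Y [fY sYX eYX]]]; first by exists [::]; rewrite nil_free.
have [xX|xNX] := boolP (x \in <<X>>%VS).
  exists Y; split => //; first by move=> y /sYX yX; rewrite in_cons yX orbT.
  by rewrite span_cons eYX; apply/esym/addv_idPr; rewrite -memvE.
exists (x :: Y); split; first by rewrite free_cons eYX xNX.
  by move=> y; rewrite !in_cons => /orP[->|/sYX ->] //; rewrite orbT.
by rewrite !span_cons eYX.
Qed.

(** Needed because [saturates] asks for distinct points: different members of a basis span different
    lines. *)
Lemma free_mem_line (Y : seq vT) (u v : vT) :
  free Y -> u \in Y -> v \in Y -> u \in <[v]>%VS -> u = v.
Proof.
move=> fY uY vY uv; apply/eqP; apply: contraTT uv => uNv.
have pY := perm_to_rem uY.
move: fY; rewrite (perm_free pY) free_cons => /andP[uN _].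
apply: contra uN; apply/subvP.
have : v \in u :: rem u Y by rewrite -(perm_mem pY).
rewrite in_cons eq_sym (negPf uNv) /= => vr.
by rewrite -memvE memv_span.
Qed.

End Vspace.

Lemma mem_span_submx (K : fieldType) (k : nat) (s : seq 'rV[K]_k) (v : 'rV[K]_k) :
  v \in <<s>>%VS -> (v <= \matrix_(i < size s) s`_i)%MS.
Proof.
move=> vs; have := @coord_span _ _ _ (in_tuple s) v vs => ->.
apply: summx_sub => i _; apply: scalemx_sub.
by rewrite -(rowK (fun i : 'I_(size s) => s`_i) i) row_sub.
Qed.

Section Extension.

Variables (K Q : fieldType) (jota : {rmorphism K -> Q}).

(** Independence over [K] of the entries of [b], phrased with matrices so that [Q] need not carry a
    [K]-vector space structure. *)
Definition lin_indep (n : nat) (b : 'rV[Q]_n) :=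
  forall c : 'cV[K]_n, b *m map_mx jota c = 0 -> c = 0.

Lemma lin_indep_mx (n p : nat) (b : 'rV[Q]_n) (A : 'M[K]_(n, p)) :
  lin_indep b -> b *m map_mx jota A = 0 -> A = 0.
Proof.
move=> bI bA; apply/matrixP => i j.
suff /matrixP/(_ i 0) : col j A = 0 by rewrite !mxE.
by apply: bI; rewrite colE map_mxM mulmxA bA mul0mx.
Qed.

(** The cokernel matrix of [Y] encodes the linear forms vanishing on its rows and has entries in
    [K]. Hence [b] times a matrix over [K] is zero, and independence of [b] makes that matrix
    zero. *)
Lemma lin_indep_submx (n p k : nat) (b : 'rV[Q]_n) (A : 'M[K]_(n, k))
    (Y : 'M[K]_(p, k)) :
  lin_indep b -> (b *m map_mx jota A <= map_mx jota Y)%MS -> (A <= Y)%MS.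
Proof.
move=> bI; rewrite !submxE -map_cokermx -mulmxA -map_mxM => /eqP bAY.
by rewrite (lin_indep_mx bI bAY).
Qed.

Lemma mem_span_map_mx (k : nat) (Y : seq 'rV[K]_k) (v : 'rV[K]_k) :
  v \in <<Y>>%VS -> map_mx jota v \in <<map (map_mx jota) Y>>%VS.
Proof.
move=> vY; have := @coord_span _ _ _ (in_tuple Y) v vY => ->.
rewrite raddf_sum; apply: memv_suml => i _ /=; rewrite map_mxZ memvZ //.
by rewrite memv_span // map_f // mem_nth.
Qed.

(** The scalar, a priori in [Q], is a quotient of coordinates of [u] and [v], so it comes from
    [K]. *)
Lemma map_mx_mem_line (k : nat) (u v : 'rV[K]_k) :
  v != 0 -> map_mx jota u \in <[map_mx jota v]>%VS -> u \in <[v]>%VS.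
Proof.
move=> v0 /vlineP[c uv].
have /rV0Pn[j vj] := v0.
have cE : c = jota (u 0 j / v 0 j).
  have /matrixP/(_ 0 j) := uv; rewrite !mxE => uj.
  by rewrite fmorph_div uj mulfK // fmorph_eq0.
apply/vlineP; exists (u 0 j / v 0 j).
by apply/(map_mx_inj (f := jota)); rewrite map_mxZ uv cE.
Qed.

End Extension.

(** By counting: [n] elements have at most [#|K| ^ n] combinations over [K], fewer than [#|Q|], so
    some [x] avoids them all and can be adjoined. *)
Lemma lin_indep_exists (K Q : finFieldType) (jota : {rmorphism K -> Q}) (n : nat) :
  (#|K| ^ n <= #|Q|)%N -> exists b : 'rV[Q]_n, lin_indep jota b.
Proof.
elim: n => [|n IHn] le_nQ; first by exists 0 => c _; apply/matrixP => - [].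
have lt_nQ : (#|K| ^ n < #|Q|)%N.
  by apply: leq_trans le_nQ; rewrite ltn_exp2l // finNzRing_gt1.
have [b bI] := IHn (ltnW lt_nQ).
pose f (c : 'cV[K]_n) := (b *m map_mx jota c) 0 0.
have /subsetPn[x _ xNf] : ~~ ([set: Q] \subset [set f c | c : 'cV[K]_n]).
  apply/negP => /subset_leq_card; rewrite cardsT => /leq_trans/(_ (leq_imset_card _ _)).
  by rewrite card_mx muln1 leqNgt lt_nQ.
suff xbI : lin_indep jota (row_mx (x%:M : 'rV_1) b) by exists (row_mx x%:M b).
move=> c; rewrite -[c]vsubmxK map_col_mx mul_row_col.
move: (usubmx c) (dsubmx c) => a d xad.
have {}xad : x * jota (a 0 0) + f d = 0.
  have /matrixP/(_ 0 0) := xad.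
  by rewrite mul_scalar_mx mxE [RHS]mxE -/(f d) !mxE.
have a0 : a = 0.
  apply/matrixP => i j; rewrite !ord1 mxE; apply/eqP.
  (* A nonzero coefficient of [x] could be inverted, making [x] a combination of the entries of
     [b]. *)
  apply: contraNT xNf => a0; apply/imsetP; exists (- (a 0 0)^-1 *: d) => //.
  rewrite /f map_mxZ -scalemxAr mxE -/(f d) -[f d](addKr (x * jota (a 0 0))) xad.
  by rewrite addr0 rmorphN fmorphV mulrNN mulrC mulfK // fmorph_eq0.
rewrite a0 (bI d) ?col_mx0 //.
apply/matrixP => i j; rewrite !ord1 [RHS]mxE -/(f d).
by move: xad; rewrite a0 mxE rmorph0 mulr0 add0r.
Qed.

(** Independence makes [f] injective, and both sides have the same finite cardinality, so [f] is
    onto. *)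
Lemma lin_indep_generates (K Q : finFieldType) (jota : {rmorphism K -> Q}) (n p : nat)
    (b : 'rV[Q]_n) (v : 'rV[Q]_p) :
  #|Q| = (#|K| ^ n)%N -> lin_indep jota b ->
  exists A : 'M[K]_(n, p), v = b *m map_mx jota A.
Proof.
move=> cQ bI; pose f (A : 'M[K]_(n, p)) := b *m map_mx jota A.
have f_inj : injective f.
  move=> A B /eqP; rewrite -subr_eq0 -mulmxBr -map_mxB => /eqP /(lin_indep_mx bI).
  by move/eqP; rewrite subr_eq0 => /eqP.
have /inj_card_onto/(_ v) : (#|{: 'rV[Q]_p}| <= #|{: 'M[K]_(n, p)}|)%N.
  by rewrite !card_mx cQ mul1n expnM.
by case/(_ _ f_inj)/codomP => A ->; exists A.
Qed.

Section Systems.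

Variables (K Q : finFieldType) (jota : {rmorphism K -> Q}) (k t : nat).
Variable U : 'I_t -> {set 'rV[K]_k}.

Lemma linear_sets_unionP (R : finFieldType) (V : 'I_t -> {set 'rV[R]_k}) P :
  reflect (exists i, exists2 u, u \in V i & u != 0 /\ P = <[u]>%VS)
          (linear_sets_union V P).
Proof.
apply: (iffP existsP) => -[i].
  by case/existsP => u /and3P[uV u0 /eqP ->]; exists i, u.
by case=> u uV [u0 ->]; exists i; apply/existsP; exists u; rewrite uV u0 eqxx.
Qed.

(** The vector [u] need not lie in any [U i]; it is only proportional over [K] to some [w] that
    does, and [jota] transports the proportionality. *)
Lemma linear_sets_union_map (u : 'rV[K]_k) :
  linear_sets_union U <[u]>%VS ->
  linear_sets_union (extend_system jota U) <[map_mx jota u]>%VS.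
Proof.
case/linear_sets_unionP => i [w wU [w0 uw]].
apply/linear_sets_unionP; exists i, (map_mx jota w); first exact: imset_f.
split; first by rewrite map_mx_eq0.
have /vlineP[a ua] : u \in <[w]>%VS by rewrite -uw memv_line.
have /vlineP[c wc] : w \in <[u]>%VS by rewrite uw memv_line.
apply: subv_anti; rewrite -!memvE; apply/andP; split; apply/vlineP.
  by exists (jota a); rewrite -map_mxZ -ua.
by exists (jota c); rewrite -map_mxZ -wc.
Qed.

Lemma linear_sets_union_extendP P :
  linear_sets_union (extend_system jota U) P -> exists u, P = <[map_mx jota u]>%VS.
Proof. by case/linear_sets_unionP => i [_ /imsetP[u _ ->] [_ ->]]; exists u. Qed.

Lemma extend_is_system (F : finFieldType) (iota : {rmorphism F -> K}) :
  is_system iota U -> is_system (jota \o iota) (extend_system jota U).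
Proof.
case=> subU spanU; split.
  move=> i; have [U0 UD UZ] := subU i; split.
  - by apply/imsetP; exists 0; rewrite ?map_mx0.
  - move=> _ _ /imsetP[u uU ->] /imsetP[v vU ->].
    by rewrite -map_mxD imset_f // UD.
  by move=> a _ /imsetP[u uU ->]; rewrite /= -map_mxZ imset_f // UZ.
apply/eqP; rewrite eqEsubv subvf /=; apply/subvP => v _.
(* The standard basis of [Q^k] is the image of that of [K^k], which the system spans. *)
rewrite [v]row_sum_delta; apply: memv_suml => j _; apply: memvZ.
rewrite -(map_delta_mx jota).
have : delta_mx 0 j \in <<enum (\bigcup_i U i)>>%VS by rewrite spanU memvf.
move/(mem_span_map_mx jota); apply/subvP/sub_span => w /mapP[u].
rewrite mem_enum => /bigcupP[i _ ui] ->.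
by rewrite mem_enum; apply/bigcupP; exists i => //; apply: imset_f.
Qed.

(** Writing [k] as [n.+2] avoids subtraction: the degree of [Q] over [K], the dimension of a
    hyperplane and the number of points used are all [n.+1]. *)
Lemma strong_blocking_saturates (n : nat) :
  k = n.+2 -> #|Q| = (#|K| ^ n.+1)%N -> strong_blocking (linear_sets_union U) ->
  saturates (linear_sets_union (extend_system jota U)) n.
Proof.
move=> kE cQ blockU P /eqP dP.
have [b bI] : exists b : 'rV[Q]_n.+1, lin_indep jota b.
  by apply: lin_indep_exists; rewrite cQ.
have [A vA] := lin_indep_generates (vpick P) cQ bI.
pose rowsA := [seq row i A | i : 'I_n.+1].
have [H sAH dH] : exists2 H, (<<rowsA>> <= H)%VS & \dim H = n.+1.
  apply: exists_supspace_dim; rewrite dimvf /dim /= mul1n.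
  apply/andP; split; last by rewrite kE.
  by apply: leq_trans (dim_span _) _; rewrite size_map size_enum_ord.
have /blockU : is_hyperplane H by rewrite /is_hyperplane dH kE subn1.
rewrite /span_points -big_filter -span_def.
set X := filter _ _ => spanX.
have [Y [fY sYX eYX]] := free_subset_span X.
have Yprop y : y \in Y -> y != 0 /\ linear_sets_union U <[y]>%VS.
  by move=> /sYX; rewrite mem_filter => /andP[/and3P[]].
pose T := [seq <[map_mx jota y]>%VS | y <- Y].
have sT : size T == n.+1.
  by rewrite size_map; move: fY; rewrite /free eYX spanX dH eq_sym.
exists (Tuple sT); split => /=.
(* Equality of two lines over [Q] descends to [K], where freeness of [Y] applies. *)
- rewrite map_inj_in_uniq ?free_uniq // => u v uY vY uv.
  have [v0 _] := Yprop v vY.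
  apply: (free_mem_line fY uY vY); apply: (map_mx_mem_line (jota := jota) v0).
  by rewrite -uv memv_line.
- by apply/allP => _ /mapP[y /Yprop[_ yU] ->]; exact: linear_sets_union_map.
have -> : (\sum_(W <- T) W)%VS = <<map (map_mx jota) Y>>%VS.
  by rewrite span_def !big_map.
have -> : P = <[vpick P]>%VS.
  apply/esym/eqP; rewrite eqEdim -memvE memv_pick dP dim_vline vpick0.
  by rewrite -dimv_eq0 dP.
rewrite -memvE vA mulmx_sum_row; apply: memv_suml => i _; apply: memvZ.
rewrite -map_row; apply: mem_span_map_mx; rewrite eYX spanX.
by apply: (subvP sAH); apply/memv_span/map_f; rewrite mem_enum.
Qed.

Lemma extend_saturates_lb (n s : nat) :
  (n <= k)%N -> #|Q| = (#|K| ^ n)%N -> (0 < n)%N ->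
  saturates (linear_sets_union (extend_system jota U)) s -> (n <= s.+1)%N.
Proof.
move=> lenk cQ n0 satU.
have [b bI] : exists b : 'rV[Q]_n, lin_indep jota b.
  by apply: lin_indep_exists; rewrite cQ.
(* Since [n <= k], the rows of [A] are the first [n] unit vectors; they are the independent
   [a_i]. *)
pose A : 'M[K]_(n, k) := pid_mx n.
have rA : \rank A = n by rewrite rank_pid_mx.
pose v := b *m map_mx jota A.
have v0 : v != 0.
  by apply/eqP => /(lin_indep_mx bI) A0; move: rA n0; rewrite A0 mxrank0 => <-.
have [|T [_ /allP TU vT]] := satU <[v]>%VS; first by rewrite /is_point dim_vline v0.
have [Y TY] : exists Y : seq 'rV[K]_k,
    tval T = [seq <[map_mx jota y]>%VS | y <- Y].
  have : forall X, X \in tval T -> exists u, X = <[map_mx jota u]>%VS.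
    by move=> X /TU/linear_sets_union_extendP.
  elim: (tval T) => [|X T' IHT] TP; first by exists [::].
  have [|Y ->] := IHT; first by move=> Z ZT; apply: TP; rewrite in_cons ZT orbT.
  by have [u ->] := TP X (mem_head _ _); exists (u :: Y).
have sY : size Y = s.+1 by rewrite -(size_tuple T) TY size_map.
have : v \in <<map (map_mx jota) Y>>%VS.
  by rewrite memvE span_def big_map; move: vT; rewrite TY big_map.
move/mem_span_submx; rewrite size_map.
set M := \matrix_i _.
have -> : M = map_mx jota (\matrix_(i < size Y) Y`_i).
  by apply/matrixP => i j; rewrite !mxE (nth_map 0) // mxE.
(* The inclusion descends to [K]: the row space of [A], of dimension [n], lies in the span of the
   [s.+1] vectors of [Y]. *)
move/(lin_indep_submx bI)/mxrankS; rewrite rA => /leq_trans; apply.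
by rewrite -sY rank_leq_row.
Qed.

End Systems.

Theorem theorem4p6 (q m t k : nat)
    (hm : (0 < m)%N) (ht : (0 < t)%N) (hk : (2 <= k)%N)
    (Fq Fqm FQ : finFieldType)
    (cardFq : #|Fq| = q)
    (cardFqm : #|Fqm| = (q ^ m)%N)
    (cardFQ : #|FQ| = (q ^ (m * (k - 1)))%N)
    (iota : {rmorphism Fq -> Fqm}) (jota : {rmorphism Fqm -> FQ})
    (U : 'I_t -> {set 'rV[Fqm]_k}) (cutU : cutting_system iota U) :
  sum_rank_saturating_system (jota \o iota) (extend_system jota U) (k - 1).
Proof.
have [sysU blockU] := cutU.
have cQ : #|FQ| = (#|Fqm| ^ (k - 1))%N by rewrite cardFQ cardFqm expnM.
split; [exact: extend_is_system | by rewrite subn_gt0 | split].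
  have kE : (k - 1 - 1).+1 = (k - 1)%N by rewrite subn1 prednK // subn_gt0.
  apply: strong_blocking_saturates blockU; last by rewrite kE.
  by rewrite kE subn1 prednK // ltnW.
(* The bound is used with [n = k - 1]: it gives [k - 1 <= s.+1], against [s < k - 1 - 1]. *)
move=> s; rewrite ltn_subRL add1n => lt_s /(extend_saturates_lb (leq_subr _ _) cQ).
by rewrite subn_gt0 => /(_ hk); rewrite leqNgt lt_s.
Qed.
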